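(* Let $D$ be an algebra with multiplication $\mu$ and $T$ a twistor for $D$. (i) Let $V$ be a left $D$-module with action $\lambda:D\otimes V\to V$. Let $\Gamma:D\otimes V\to D\otimes V$ be a linear map such that $\Gamma(1\otimes v)=1\otimes v$ for all $v\in V$, and $$\lambda_{23}\circ\Gamma_{13}\circ T_{12}=\Gamma\circ\lambda_{23}:D\otimes D\otimes V\to D\otimes V,$$ $$\mu_{12}\circ\Gamma_{13}\circ\Gamma_{23}=\Gamma\circ\mu_{12}:D\otimes D\otimes V\to D\otimes V,$$ $$T_{12}\circ\Gamma_{23}=\Gamma_{23}\circ T_{12}:D\otimes D\otimes V\to D\otimes D\otimes V.$$ Then $V$ becomes a left $D^T$-module with action $\lambda\circ\Gamma:D\otimes V\to V$; this module is denoted $V^\Gamma$, and $\Gamma$ is called a left module twistor for $V$ relative to $T$. (ii) Let $V$ be a right $D$-module with action $\rho:V\otimes D\to V$. Let $\Pi:V\otimes D\to V\otimes D$ be a linear map such that $\Pi(v\otimes 1)=v\otimes 1$ for all $v\in V$, and $$\mu_{23}\circ\Pi_{13}\circ\Pi_{12}=\Pi\circ\mu_{23}:V\otimes D\otimes D\to V\otimes D,$$ $$\rho_{12}\circ\Pi_{13}\circ T_{23}=\Pi\circ\rho_{12}:V\otimes D\otimes D\to V\otimes D,$$ $$\Pi_{12}\circ T_{23}=T_{23}\circ\Pi_{12}:V\otimes D\otimes D\to V\otimes D\otimes D.$$ Then $V$ becomes a right $D^T$-module with action $\rho\circ\Pi:V\otimes D\to V$; this module is denoted ${}^{\Pi}V$,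 and $\Pi$ is called a right module twistor for $V$ relative to $T$. (iii) Let $V$ be a $D$-bimodule with left action $\lambda$ and right action $\rho$, and let $\Gamma$ and $\Pi$ be a left, respectively a right, module twistor for $V$ relative to $T$. Assume that $$\rho_{23}\circ T_{13}\circ\Gamma_{12}=\Gamma\circ\rho_{23}:D\otimes V\otimes D\to D\otimes V,$$ $$\lambda_{12}\circ T_{13}\circ\Pi_{23}=\Pi\circ\lambda_{12}:D\otimes V\otimes D\to V\otimes D,$$ $$\Gamma_{12}\circ\Pi_{23}=\Pi_{23}\circ\Gamma_{12}:D\otimes V\otimes D\to D\otimes V\otimes D.$$ Then the vector space $V$, endowed with the left $D^T$-module structure of $V^\Gamma$ and the right $D^T$-module structure of ${}^{\Pi}V$, is a $D^T$-bimodule.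
   Context: $k$ is a field, $\otimes=\otimes_k$, algebras are associative unital $k$-algebras. For a map $f$ on two tensor factors, $f_{ij}$ denotes $f$ acting on the $i$-th and $j$-th factors of a threefold tensor product (identity on the remaining one); e.g. $\lambda_{23}=\mathrm{id}_D\otimes\lambda$, $\mu_{12}=\mu\otimes\mathrm{id}$. A twistor for $D$ is a linear map $T:D\otimes D\to D\otimes D$ with $T(1\otimes d)=1\otimes d$, $T(d\otimes 1)=d\otimes 1$ for all $d\in D$ and, on $D\otimes D\otimes D$, $\mu_{23}\circ T_{13}\circ T_{12}=T\circ\mu_{23}$, $\mu_{12}\circ T_{13}\circ T_{23}=T\circ\mu_{12}$, $T_{12}\circ T_{23}=T_{23}\circ T_{12}$. Then $D^T$ denotes the associative algebra on the vector space $D$ with multiplication $\mu\circ T$ and the same unit. *)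

(* Defs.v *)
From HB Require Import structures.
From mathcomp Require Import all_boot all_algebra.
From mathcomp Require Import boolp.
From mathcomp Require Import freeg.

Set Implicit Arguments.
Unset Strict Implicit.
Unset Printing Implicit Defensive.

Import GRing.Theory.

Local Open Scope ring_scope.
Local Open Scope quotient_scope.

(* The tensor product of two (possibly infinite-dimensional) vector spaces:
   the free vector space on U * V modulo the span of the bilinearity
   relators. *)
Section Tensor.
Context (k : fieldType) (U V : lmodType k).
Local Notation F := {freeg (U * V)%type / k}.
Local Notation "[[ u , v ]]" := (<<(u, v)>> : F).

Inductive tensor_rel : F -> Prop :=
| tensor_rel0 : tensor_rel 0
| tensor_rel_lin (c : k) x y :
    tensor_rel x -> tensor_rel y -> tensor_rel (c *: x + y)
| tensor_relDl u u' v : tensor_rel ([[u + u', v]] - [[u, v]] - [[u', v]])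
| tensor_relDr u v v' : tensor_rel ([[u, v + v']] - [[u, v]] - [[u, v']])
| tensor_relZl c u v : tensor_rel ([[c *: u, v]] - c *: [[u, v]])
| tensor_relZr c u v : tensor_rel ([[u, c *: v]] - c *: [[u, v]]).

Definition tensor_pred : {pred F} := fun x => `[< tensor_rel x >].

Fact tensor_zmod_closed : zmod_closed tensor_pred.
Proof.
split; first by apply/asboolP; exact: tensor_rel0.
move=> x y /asboolP hx /asboolP hy; apply/asboolP.
by rewrite addrC -scaleN1r; exact: tensor_rel_lin.
Qed.

HB.instance Definition _ :=
  GRing.isZmodClosed.Build F tensor_pred tensor_zmod_closed.

Definition tensor : Type := Quotient.quot tensor_pred.
HB.instance Definition _ := GRing.Zmodule.on tensor.
HB.instance Definition _ := ZmodQuotient.on tensor.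

Fact tensor_eqP (x y : F) :
  reflect (\pi_tensor x = \pi_tensor y) (x - y \in tensor_pred).
Proof. by rewrite Quotient.idealrBE; exact: eqP. Qed.

Definition tensor_scale (c : k) : tensor -> tensor :=
  lift_op1 tensor ( *:%R c).

Fact pi_tensor_scale c (x : F) :
  tensor_scale c (\pi_tensor x) = \pi_tensor (c *: x).
Proof.
unlock tensor_scale; apply/tensor_eqP; rewrite -scalerBr.
have /tensor_eqP/asboolP h : \pi_tensor (repr (\pi_tensor x)) = \pi_tensor x.
  exact: reprK.
by apply/asboolP; rewrite -[_ *: _]addr0; apply: tensor_rel_lin => //; exact: tensor_rel0.
Qed.

Fact tensor_scalerA a b v :
  tensor_scale a (tensor_scale b v) = tensor_scale (a * b) v.
Proof. by elim/quotW: v => v; rewrite !pi_tensor_scale scalerA. Qed.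
Fact tensor_scale1r : left_id 1 tensor_scale.
Proof. by elim/quotW => v; rewrite pi_tensor_scale scale1r. Qed.
Fact tensor_scalerDr : right_distributive tensor_scale +%R.
Proof.
move=> a; elim/quotW=> u; elim/quotW=> v.
by rewrite -raddfD !pi_tensor_scale scalerDr raddfD.
Qed.
Fact tensor_scalerDl v : {morph tensor_scale^~ v : a b / a + b}.
Proof.
by move=> a b; elim/quotW: v => v; rewrite !pi_tensor_scale scalerDl raddfD.
Qed.

HB.instance Definition _ := GRing.Zmodule_isLmodule.Build k tensor
  tensor_scalerA tensor_scale1r tensor_scalerDr tensor_scalerDl.

Definition tens (u : U) (v : V) : tensor := \pi_tensor [[u, v]].

Fact tens_bilinear : bilinear_for
  (GRing.Scale.Law.clone _ _ *:%R _) (GRing.Scale.Law.clone _ _ *:%R _) tens.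
Proof.
split=> [v|u] c x y; rewrite /tens.
  have -> : \pi_tensor [[c *: x + y, v]] =
            \pi_tensor [[c *: x, v]] + \pi_tensor [[y, v]].
    rewrite -raddfD; apply/tensor_eqP/asboolP.
    by rewrite opprD addrA; exact: tensor_relDl.
  congr (_ + _); rewrite [RHS]pi_tensor_scale.
  exact/tensor_eqP/asboolP/tensor_relZl.
have -> : \pi_tensor [[u, c *: x + y]] =
          \pi_tensor [[u, c *: x]] + \pi_tensor [[u, y]].
  rewrite -raddfD; apply/tensor_eqP/asboolP.
  by rewrite opprD addrA; exact: tensor_relDr.
congr (_ + _); rewrite [RHS]pi_tensor_scale.
exact/tensor_eqP/asboolP/tensor_relZr.
Qed.

HB.instance Definition _ :=
  bilinear_isBilinear.Build k U V tensor *:%R *:%R tens tens_bilinear.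

Lemma tensor_ind (P : tensor -> Prop) :
  (forall u v, P (tens u v)) ->
  (forall c x y, P x -> P y -> P (c *: x + y)) -> forall x, P x.
Proof.
move=> Pt PD x; have P0 : P 0.
  by have := PD (-1) _ _ (Pt 0 0) (Pt 0 0); rewrite scaleN1r addNr.
elim/quotW: x => x; elim/freeg_ind_dom0: x => [|c [u v] y _ _ IH].
  by rewrite raddf0.
have -> : <<c *g (u, v)>> = c *: [[u, v]].
  by apply/eqP/freeg_eqP => z; rewrite coeffZ !coeffU mul1r.
suff -> : \pi_tensor (c *: [[u, v]] + y) = c *: tens u v + \pi_tensor y.
  exact: PD.
by rewrite raddfD; congr (_ + _); exact: esym (pi_tensor_scale c _).
Qed.

Lemma tensor_ext (W : lmodType k) (f g : {linear tensor -> W}) :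
  (forall u v, f (tens u v) = g (tens u v)) -> f =1 g.
Proof.
by move=> fg; elim/tensor_ind => // c x y IHx IHy; rewrite !linearP IHx IHy.
Qed.

Section Lift.
Context (W : lmodType k) (f : {bilinear U -> V -> W}).

Definition tlift (x : tensor) : W := fglift (fun p => f p.1 p.2) (repr x).

Let g := fglift (fun p : U * V => f p.1 p.2).

Let gB : {morph g : x y / x - y}.
Proof. exact: lift_is_additive. Qed.
Let g0 : g 0 = 0.
Proof. by rewrite -(subrr 0) gB subrr. Qed.
Let gD : {morph g : x y / x + y}.
Proof.
have gN x : g (- x) = - g x by rewrite -sub0r gB g0 sub0r.
by move=> x y; rewrite -[y in LHS]opprK gB gN opprK.
Qed.
Let gZ c : {morph g : x / c *: x}.
Proof.
elim/freeg_ind_dom0=> [|d p x _ _ IH]; first by rewrite scaler0 g0 scaler0.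
rewrite scalerDr !gD IH scalerDr; congr (_ + _).
have -> : c *: <<d *g p>> = <<c * d *g p>>.
  by apply/eqP/freeg_eqP => z; rewrite coeffZ !coeffU mulrA.
by rewrite /g !liftU scalerA.
Qed.
Let gU u v : g [[u, v]] = f u v.
Proof. by rewrite /g liftU scale1r. Qed.

Let g_tensor_rel x : tensor_rel x -> g x = 0.
Proof.
elim=> [|c {}x y _ hx _ hy|u u' v|u v v'|c u v|c u v].
- exact: g0.
- by rewrite gD gZ hx hy scaler0 addr0.
- by rewrite !gB !gU linearDl -addrA -opprD subrr.
- by rewrite !gB !gU linearDr -addrA -opprD subrr.
- by rewrite gB gZ !gU linearZl_LR subrr.
- by rewrite gB gZ !gU linearZr_LR subrr.
Qed.

Let tlift_pi x : tlift (\pi_tensor x) = g x.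
Proof.
apply/eqP; rewrite -subr_eq0 -[tlift _]/(g (repr _)) -gB.
apply/eqP/g_tensor_rel.
have /tensor_eqP/asboolP : \pi_tensor (repr (\pi_tensor x)) = \pi_tensor x.
  exact: reprK.
by [].
Qed.

Fact tlift_linear : linear tlift.
Proof.
move=> c; elim/quotW=> x; elim/quotW=> y.
rewrite [c *: _]pi_tensor_scale -raddfD !tlift_pi gD; congr (_ + _); exact: gZ.
Qed.

HB.instance Definition _ := GRing.isLinear.Build k tensor W *:%R
  tlift tlift_linear.

Lemma tliftE u v : tlift (tens u v) = f u v.
Proof. by rewrite tlift_pi gU. Qed.

End Lift.
End Tensor.

Arguments tensor {k} U V.
Arguments tens {k U V} u v.

Notation "U ⊗ V" := (tensor U V)
  (at level 40, left associativity) : type_scope.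
(* [{linear _ -> _}] parses its arguments in [ring_scope]. *)
Notation "U ⊗ V" := (tensor U V) : ring_scope.
Notation "u ⊗ₜ v" := (tens u v)
  (at level 40, left associativity) : ring_scope.

Definition mk_bilinear (k : fieldType) (U V W : lmodType k) (b : U -> V -> W)
    (hl : forall v, linear (b^~ v)) (hr : forall u, linear (b u)) :
    {bilinear U -> V -> W} :=
  HB.pack b (bilinear_isBilinear.Build k U V W *:%R *:%R b (hl, hr)).

Section TensorMap.
Context (k : fieldType) (U V U' V' : lmodType k).
Context (f : {linear U -> U'}) (g : {linear V -> V'}).

Definition tmap_fun (u : U) (v : V) : U' ⊗ V' := f u ⊗ₜ g v.

Fact tmap_linearl v : linear (tmap_fun^~ v).
Proof. by move=> c x y; rewrite /tmap_fun linearP linearPl. Qed.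
Fact tmap_linearr u : linear (tmap_fun u).
Proof. by move=> c x y; rewrite /tmap_fun linearP linearPr. Qed.

Definition tmap : {linear U ⊗ V -> U' ⊗ V'} :=
  tlift (mk_bilinear tmap_linearl tmap_linearr).

Lemma tmapE u v : tmap (u ⊗ₜ v) = f u ⊗ₜ g v.
Proof. exact: tliftE. Qed.

End TensorMap.

Section Associator.
Context (k : fieldType) (U V W : lmodType k).

Fact tassoc_at_linearl (w : W) (v : V) :
  linear (fun u : U => u ⊗ₜ (v ⊗ₜ w)).
Proof. by move=> c x y; rewrite linearPl. Qed.
Fact tassoc_at_linearr (w : W) (u : U) :
  linear (fun v : V => u ⊗ₜ (v ⊗ₜ w)).
Proof. by move=> c x y; rewrite linearPl linearPr. Qed.
Definition tassoc_at (w : W) : {linear U ⊗ V -> U ⊗ (V ⊗ W)} :=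
  tlift (mk_bilinear (tassoc_at_linearl w) (tassoc_at_linearr w)).
Fact tassoc_atE w u v : tassoc_at w (u ⊗ₜ v) = u ⊗ₜ (v ⊗ₜ w).
Proof. exact: tliftE. Qed.

Fact tassoc_linearl w : linear (tassoc_at w).
Proof. exact: linearP. Qed.
Fact tassoc_linearr x : linear (tassoc_at^~ x).
Proof.
move=> c w w'; elim/tensor_ind: x => [u v|d x y IHx IHy].
  by rewrite !tassoc_atE !linearPr.
by rewrite !linearP IHx IHy !scalerDr !scalerA mulrC addrACA.
Qed.
Definition tassoc : {linear U ⊗ V ⊗ W -> U ⊗ (V ⊗ W)} :=
  tlift (mk_bilinear tassoc_linearl tassoc_linearr).

Lemma tassocE u v w : tassoc (u ⊗ₜ v ⊗ₜ w) = u ⊗ₜ (v ⊗ₜ w).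
Proof. by rewrite [LHS]tliftE; exact: tassoc_atE. Qed.

Fact tassocV_at_linearl (u : U) (w : W) :
  linear (fun v : V => u ⊗ₜ v ⊗ₜ w).
Proof. by move=> c x y; rewrite linearPr linearPl. Qed.
Fact tassocV_at_linearr (u : U) (v : V) :
  linear (fun w : W => u ⊗ₜ v ⊗ₜ w).
Proof. by move=> c x y; rewrite linearPr. Qed.
Definition tassocV_at (u : U) : {linear V ⊗ W -> U ⊗ V ⊗ W} :=
  tlift (mk_bilinear (tassocV_at_linearl u) (tassocV_at_linearr u)).
Fact tassocV_atE u v w : tassocV_at u (v ⊗ₜ w) = u ⊗ₜ v ⊗ₜ w.
Proof. exact: tliftE. Qed.

Fact tassocV_linearr u : linear (tassocV_at u).
Proof. exact: linearP. Qed.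
Fact tassocV_linearl x : linear (tassocV_at^~ x).
Proof.
move=> c u u'; elim/tensor_ind: x => [v w|d x y IHx IHy].
  by rewrite !tassocV_atE !linearPl.
by rewrite !linearP IHx IHy !scalerDr !scalerA mulrC addrACA.
Qed.
Definition tassocV : {linear U ⊗ (V ⊗ W) -> U ⊗ V ⊗ W} :=
  tlift (mk_bilinear tassocV_linearl tassocV_linearr).

Lemma tassocVE u v w : tassocV (u ⊗ₜ (v ⊗ₜ w)) = u ⊗ₜ v ⊗ₜ w.
Proof. by rewrite [LHS]tliftE; exact: tassocV_atE. Qed.

Lemma tassocVK : cancel tassocV tassoc.
Proof.
elim/tensor_ind => [u x|c x y IHx IHy]; last by rewrite !linearP IHx IHy.
elim/tensor_ind: x => [v w|c x y IHx IHy]; last by rewrite linearPr !linearP IHx IHy.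
by rewrite tassocVE tassocE.
Qed.

Lemma tensor3_ext (X : lmodType k) (f g : {linear U ⊗ V ⊗ W -> X}) :
  (forall u v w, f (u ⊗ₜ v ⊗ₜ w) = g (u ⊗ₜ v ⊗ₜ w)) -> f =1 g.
Proof.
move=> fg; apply: tensor_ext => x w.
elim/tensor_ind: x => [u v|c x y IHx IHy]; first exact: fg.
by rewrite linearPl !linearP IHx IHy.
Qed.

Lemma tassocK : cancel tassoc tassocV.
Proof.
move=> x; apply: (tensor3_ext (f := tassocV \o tassoc) (g := idfun)) => u v w.
by rewrite /= tassocE tassocVE.
Qed.

End Associator.

Section Swap.
Context (k : fieldType) (U V : lmodType k).

Fact tswap_linearl (v : V) : linear (fun u : U => v ⊗ₜ u).
Proof. by move=> c x y; rewrite linearPr. Qed.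
Fact tswap_linearr (u : U) : linear (fun v : V => v ⊗ₜ u).
Proof. by move=> c x y; rewrite linearPl. Qed.
Definition tswap : {linear U ⊗ V -> V ⊗ U} :=
  tlift (mk_bilinear tswap_linearl tswap_linearr).

Lemma tswapE u v : tswap (u ⊗ₜ v) = v ⊗ₜ u.
Proof. exact: tliftE. Qed.

End Swap.

Definition tswap23 (k : fieldType) (U V W : lmodType k) :
    {linear U ⊗ V ⊗ W -> U ⊗ W ⊗ V} :=
  tassocV U W V \o tmap idfun (tswap V W) \o tassoc U V W.

Lemma tswap23E (k : fieldType) (U V W : lmodType k) (u : U) (v : V) (w : W) :
  tswap23 U V W (u ⊗ₜ v ⊗ₜ w) = u ⊗ₜ w ⊗ₜ v.
Proof. by rewrite /= tassocE tmapE tswapE tassocVE. Qed.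

(* Threefold tensor products U ⊗ V ⊗ W are bracketed to the left. [on12 f] is
   f_{12} and [on23 f] is f_{23} for f with an arbitrary codomain, regarded as
   a single factor (as in mu_{12}, lambda_{23}); when the codomain of f is
   again a tensor product of two spaces, [leg12], [leg13] and [leg23] are
   f_{12}, f_{13} and f_{23} with values in a threefold tensor product. *)
Section Legs.
Context (k : fieldType) (U V W : lmodType k).

Definition on12 (X : lmodType k) (f : {linear U ⊗ V -> X}) :
  {linear U ⊗ V ⊗ W -> X ⊗ W} := tmap f idfun.

Definition on23 (X : lmodType k) (f : {linear V ⊗ W -> X}) :
  {linear U ⊗ V ⊗ W -> U ⊗ X} := tmap idfun f \o tassoc U V W.

Definition leg12 (f : {linear U ⊗ V -> U ⊗ V}) :
  {linear U ⊗ V ⊗ W -> U ⊗ V ⊗ W} := on12 f.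

Definition leg23 (f : {linear V ⊗ W -> V ⊗ W}) :
  {linear U ⊗ V ⊗ W -> U ⊗ V ⊗ W} := tassocV U V W \o on23 f.

Definition leg13 (f : {linear U ⊗ W -> U ⊗ W}) :
    {linear U ⊗ V ⊗ W -> U ⊗ V ⊗ W} :=
  tswap23 U W V \o tmap f idfun \o tswap23 U V W.

Lemma on12E (X : lmodType k) (f : {linear U ⊗ V -> X}) x w :
  on12 f (x ⊗ₜ w) = f x ⊗ₜ w.
Proof. exact: tmapE. Qed.

Lemma on23E (X : lmodType k) (f : {linear V ⊗ W -> X}) u v w :
  on23 f (u ⊗ₜ v ⊗ₜ w) = u ⊗ₜ f (v ⊗ₜ w).
Proof. by rewrite /= tassocE; exact: tmapE. Qed.

Lemma leg13E (f : {linear U ⊗ W -> U ⊗ W}) u v w :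
  leg13 f (u ⊗ₜ v ⊗ₜ w) = tswap23 U W V (f (u ⊗ₜ w) ⊗ₜ v).
Proof.
rewrite -[LHS]/(tswap23 U W V (tmap f idfun (tswap23 U V W (u ⊗ₜ v ⊗ₜ w)))).
by rewrite tswap23E tmapE.
Qed.

Lemma on23_leg23 (X : lmodType k) (g : {linear V ⊗ W -> X})
    (f : {linear V ⊗ W -> V ⊗ W}) u v w :
  on23 g (leg23 f (u ⊗ₜ v ⊗ₜ w)) = u ⊗ₜ g (f (v ⊗ₜ w)).
Proof.
have -> : on23 g (leg23 f (u ⊗ₜ v ⊗ₜ w)) =
          tmap idfun g (on23 f (u ⊗ₜ v ⊗ₜ w)).
  have h := congr1 (tmap idfun g) (tassocVK (on23 f (u ⊗ₜ v ⊗ₜ w))); exact: h.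
by rewrite on23E; exact: tmapE.
Qed.

End Legs.

Arguments on12 {k U V W X} f.
Arguments on23 {k U V W X} f.
Arguments leg12 {k U V W} f.
Arguments leg13 {k U V W} f.
Arguments leg23 {k U V W} f.

(* The [algType] of the library requires 1 != 0, which would exclude the zero
   algebra; the structure maps are linear maps on tensor products so that the
   deformed product mu \o T is again one. *)
Record algebra (k : fieldType) := Algebra {
  alg_sort :> lmodType k;
  alg_mul : {linear alg_sort ⊗ alg_sort -> alg_sort};
  alg_one : alg_sort;
  alg_mulA : forall x y z,
    alg_mul (x ⊗ₜ alg_mul (y ⊗ₜ z)) = alg_mul (alg_mul (x ⊗ₜ y) ⊗ₜ z);
  alg_mul1x : forall x, alg_mul (alg_one ⊗ₜ x) = x;
  alg_mulx1 : forall x, alg_mul (x ⊗ₜ alg_one) = x }.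

Arguments alg_mul {k} a.
Arguments alg_one {k} a.

Record is_twistor (k : fieldType) (D : algebra k)
    (T : {linear D ⊗ D -> D ⊗ D}) : Prop := IsTwistor {
  twistor_1x : forall d, T (alg_one D ⊗ₜ d) = alg_one D ⊗ₜ d;
  twistor_x1 : forall d, T (d ⊗ₜ alg_one D) = d ⊗ₜ alg_one D;
  twistor_mulr :
    on23 (alg_mul D) \o leg13 T \o leg12 T =1 T \o on23 (alg_mul D);
  twistor_mull :
    on12 (alg_mul D) \o leg13 T \o leg23 T =1 T \o on12 (alg_mul D);
  twistor_comm : leg12 T \o leg23 T =1 leg23 T \o leg12 T }.

Section TwistedAlgebra.
Context (k : fieldType) (D : algebra k) (T : {linear D ⊗ D -> D ⊗ D}).
Context (hT : is_twistor T).

Definition twisted_mul : {linear D ⊗ D -> D} := alg_mul D \o T.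

Fact twisted_mulA x y z :
  twisted_mul (x ⊗ₜ twisted_mul (y ⊗ₜ z)) =
  twisted_mul (twisted_mul (x ⊗ₜ y) ⊗ₜ z).
Proof.
have mulA (t : D ⊗ D ⊗ D) :
    alg_mul D (on23 (alg_mul D) t) = alg_mul D (on12 (alg_mul D) t).
  apply: (tensor3_ext (f := alg_mul D \o on23 (alg_mul D))
                      (g := alg_mul D \o on12 (alg_mul D))) => {}x {}y {}z.
  by rewrite /= tassocE !tmapE /= alg_mulA.
pose t := x ⊗ₜ y ⊗ₜ z.
have -> : x ⊗ₜ twisted_mul (y ⊗ₜ z) = on23 (alg_mul D) (leg23 T t).
  exact: esym (on23_leg23 (alg_mul D) T x y z).
have -> : twisted_mul (x ⊗ₜ y) ⊗ₜ z = on12 (alg_mul D) (leg12 T t).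
  by rewrite [leg12 T t]on12E [RHS]on12E.
rewrite [LHS]/= [RHS]/=.
have /= <- := twistor_mulr hT (leg23 T t).
have /= <- := twistor_mull hT (leg12 T t).
by have /= -> := twistor_comm hT t; exact: mulA.
Qed.

Fact twisted_mul1x x : twisted_mul (alg_one D ⊗ₜ x) = x.
Proof. by rewrite /= twistor_1x // alg_mul1x. Qed.

Fact twisted_mulx1 x : twisted_mul (x ⊗ₜ alg_one D) = x.
Proof. by rewrite /= twistor_x1 // alg_mulx1. Qed.

Definition twisted_algebra : algebra k :=
  Algebra twisted_mulA twisted_mul1x twisted_mulx1.

End TwistedAlgebra.

Record is_left_module (k : fieldType) (A : algebra k) (V : lmodType k)
    (lam : {linear A ⊗ V -> V}) : Prop := IsLeftModule {
  left_act1 : forall v, lam (alg_one A ⊗ₜ v) = v;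
  left_actA : forall a b v,
    lam (alg_mul A (a ⊗ₜ b) ⊗ₜ v) = lam (a ⊗ₜ lam (b ⊗ₜ v)) }.

Record is_right_module (k : fieldType) (A : algebra k) (V : lmodType k)
    (rho : {linear V ⊗ A -> V}) : Prop := IsRightModule {
  right_act1 : forall v, rho (v ⊗ₜ alg_one A) = v;
  right_actA : forall v a b,
    rho (v ⊗ₜ alg_mul A (a ⊗ₜ b)) = rho (rho (v ⊗ₜ a) ⊗ₜ b) }.

Record is_bimodule (k : fieldType) (A : algebra k) (V : lmodType k)
    (lam : {linear A ⊗ V -> V}) (rho : {linear V ⊗ A -> V}) : Prop :=
  IsBimodule {
    bimodule_left : is_left_module lam;
    bimodule_right : is_right_module rho;
    bimodule_actA : forall a v b,
      rho (lam (a ⊗ₜ v) ⊗ₜ b) = lam (a ⊗ₜ rho (v ⊗ₜ b)) }.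

Record is_left_module_twistor (k : fieldType) (D : algebra k)
    (T : {linear D ⊗ D -> D ⊗ D}) (V : lmodType k) (lam : {linear D ⊗ V -> V})
    (Gam : {linear D ⊗ V -> D ⊗ V}) : Prop := IsLeftModuleTwistor {
  left_twistor_1 : forall v, Gam (alg_one D ⊗ₜ v) = alg_one D ⊗ₜ v;
  left_twistor_act : on23 lam \o leg13 Gam \o leg12 T =1 Gam \o on23 lam;
  left_twistor_mul :
    on12 (alg_mul D) \o leg13 Gam \o leg23 Gam =1 Gam \o on12 (alg_mul D);
  left_twistor_comm : leg12 T \o leg23 Gam =1 leg23 Gam \o leg12 T }.

Record is_right_module_twistor (k : fieldType) (D : algebra k)
    (T : {linear D ⊗ D -> D ⊗ D}) (V : lmodType k) (rho : {linear V ⊗ D -> V})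
    (Pi : {linear V ⊗ D -> V ⊗ D}) : Prop := IsRightModuleTwistor {
  right_twistor_1 : forall v, Pi (v ⊗ₜ alg_one D) = v ⊗ₜ alg_one D;
  right_twistor_mul :
    on23 (alg_mul D) \o leg13 Pi \o leg12 Pi =1 Pi \o on23 (alg_mul D);
  right_twistor_act : on12 rho \o leg13 Pi \o leg23 T =1 Pi \o on12 rho;
  right_twistor_comm : leg12 Pi \o leg23 T =1 leg23 T \o leg12 Pi }.

(* Main.v *)
(* Both module axioms and the bimodule axiom say that two iterated products on a
   threefold tensor product agree, and all three follow from one computation:
   push the outer twist inside by the compatibility with the inner product,
   which in both cases leaves the middle operator C_{13}, and then exchange the
   two inner twists. *)
Require Import Defs.
From mathcomp Require Import all_boot all_algebra.

Set Implicit Arguments.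
Unset Strict Implicit.
Unset Printing Implicit Defensive.

Local Open Scope ring_scope.

(** [a], [b] are the inner products, twisted by [A], [B]; [p], [q] the outer ones, twisted by [S],
    [R]. Keeping the spaces and twists independent lets the algebra sit in any two or three of the
    places. *)
Lemma twisted_assoc (k : fieldType) (U V W P Q Z : lmodType k)
    (a : {linear U ⊗ V -> P}) (b : {linear V ⊗ W -> Q})
    (p : {linear P ⊗ W -> Z}) (q : {linear U ⊗ Q -> Z})
    (A : {linear U ⊗ V -> U ⊗ V}) (B : {linear V ⊗ W -> V ⊗ W})
    (C : {linear U ⊗ W -> U ⊗ W})
    (S : {linear P ⊗ W -> P ⊗ W}) (R : {linear U ⊗ Q -> U ⊗ Q}) :
  (forall u v w, p (a (u ⊗ₜ v) ⊗ₜ w) = q (u ⊗ₜ b (v ⊗ₜ w))) ->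
  on23 b \o leg13 C \o leg12 A =1 R \o on23 b ->
  on12 a \o leg13 C \o leg23 B =1 S \o on12 a ->
  leg12 A \o leg23 B =1 leg23 B \o leg12 A ->
  forall u v w,
    p (S (a (A (u ⊗ₜ v)) ⊗ₜ w)) = q (R (u ⊗ₜ b (B (v ⊗ₜ w)))).
Proof.
move=> pq hR hS AB u v w.
(* The twists do not preserve pure tensors, so associativity is needed on all of [U ⊗ V ⊗ W]. *)
have pqE t : p (on12 a t) = q (on23 b t).
  apply: (tensor3_ext (f := p \o on12 a) (g := q \o on23 b)) => {}u {}v {}w.
  by rewrite /= tmapE tassocE tmapE pq.
set t := u ⊗ₜ v ⊗ₜ w.
have -> : a (A (u ⊗ₜ v)) ⊗ₜ w = on12 a (leg12 A t) by rewrite !on12E.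
have -> : u ⊗ₜ b (B (v ⊗ₜ w)) = on23 b (leg23 B t) by rewrite on23_leg23.
have /= <- := hS (leg12 A t).
have /= <- := hR (leg23 B t).
by have /= -> := AB t; exact: pqE.
Qed.

Theorem proposition5p4 (k : fieldType) (D : algebra k)
    (T : {linear D ⊗ D -> D ⊗ D}) (hT : is_twistor T) :
  [/\ forall (V : lmodType k) (lam : {linear D ⊗ V -> V})
        (Gam : {linear D ⊗ V -> D ⊗ V}),
        is_left_module lam -> is_left_module_twistor T lam Gam ->
        is_left_module (A := twisted_algebra hT) (lam \o Gam),
      forall (V : lmodType k) (rho : {linear V ⊗ D -> V})
        (Pi : {linear V ⊗ D -> V ⊗ D}),
        is_right_module rho -> is_right_module_twistor T rho Pi ->
        is_right_module (A := twisted_algebra hT) (rho \o Pi)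
    & forall (V : lmodType k) (lam : {linear D ⊗ V -> V})
        (rho : {linear V ⊗ D -> V}) (Gam : {linear D ⊗ V -> D ⊗ V})
        (Pi : {linear V ⊗ D -> V ⊗ D}),
        is_bimodule lam rho ->
        is_left_module_twistor T lam Gam ->
        is_right_module_twistor T rho Pi ->
        on23 rho \o leg13 T \o leg12 Gam =1 Gam \o on23 rho ->
        on12 lam \o leg13 T \o leg23 Pi =1 Pi \o on12 lam ->
        leg12 Gam \o leg23 Pi =1 leg23 Pi \o leg12 Gam ->
        is_bimodule (A := twisted_algebra hT) (lam \o Gam) (rho \o Pi)].
Proof.
have left_twisted (V : lmodType k) (lam : {linear D ⊗ V -> V})
    (Gam : {linear D ⊗ V -> D ⊗ V}) :
    is_left_module lam -> is_left_module_twistor T lam Gam ->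
    is_left_module (A := twisted_algebra hT) (lam \o Gam).
  move=> [lam1 lamA] [Gam1 Gam_act Gam_mul Gam_comm].
  split=> [v|x y v]; first by rewrite /= Gam1 lam1.
  (* Inner twists [T] and [Gam]; [C] and both outer twists are [Gam]. *)
  exact: (twisted_assoc lamA Gam_act Gam_mul Gam_comm).
have right_twisted (V : lmodType k) (rho : {linear V ⊗ D -> V})
    (Pi : {linear V ⊗ D -> V ⊗ D}) :
    is_right_module rho -> is_right_module_twistor T rho Pi ->
    is_right_module (A := twisted_algebra hT) (rho \o Pi).
  move=> [rho1 rhoA] [Pi1 Pi_mul Pi_act Pi_comm].
  split=> [v|v x y]; first by rewrite /= Pi1 rho1.
  (* The right action axiom is oriented opposite to [twisted_assoc], hence the two reversals. *)
  have rhoA' u a b := esym (rhoA u a b).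
  exact/esym/(twisted_assoc rhoA' Pi_mul Pi_act Pi_comm).
split=> // V lam rho Gam Pi [hlam hrho lam_rho] hGam hPi Gam_rho Pi_lam GamPi.
split; [exact: left_twisted | exact: right_twisted | move=> x v y].
(* With the module in the middle place, [C] joins two copies of [D] and is [T]; the inner twists are
   [Gam] and [Pi]. *)
exact: (twisted_assoc lam_rho Gam_rho Pi_lam GamPi).
Qed.
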